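(* Let $r$ and $k$ be integers with $2\le r\le k$, let $G$ be a graph, and let $e\in E(G)$. If $G-e$ is $k$-colorable and $G$ is not $k$-colorable, then $e$ lies in at least $\prod_{i=1}^{r-1}(k-i)$ cycles of $G$ whose lengths are congruent to $1$ modulo $r$.
   Context: Graphs are finite, simple and undirected. $G-e$ denotes the graph obtained from $G$ by deleting the edge $e$ (keeping all vertices). A graph is $k$-colorable if its vertices can be assigned colors from a set of $k$ colors so that adjacent vertices receive distinct colors. Cycles are counted as subgraphs (without a chosen starting vertex or direction), and the length of a cycle is its number of edges. *)

(* Defs.v *)
From mathcomp Require Import all_boot.

Set Implicit Arguments.
Unset Strict Implicit.
Unset Printing Implicit Defensive.

Record sgraph := SGraph {
  vertex :> finType;
  adj : rel vertex;
  adj_sym : symmetric adj;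
  adj_irr : irreflexive adj }.

Definition edges (G : sgraph) : {set {set G}} :=
  [set [set p.1; p.2] | p in [set p : G * G | adj p.1 p.2]].

Section DeleteEdge.
Variables (G : sgraph) (e : {set G}).

Definition del_adj : rel G := fun x y => adj x y && ([set x; y] != e).

Lemma del_adj_sym : symmetric del_adj.
Proof. by move=> x y; rewrite /del_adj adj_sym setUC. Qed.

Lemma del_adj_irr : irreflexive del_adj.
Proof. by move=> x; rewrite /del_adj adj_irr. Qed.

Definition del_edge : sgraph := SGraph del_adj_sym del_adj_irr.
End DeleteEdge.

Definition colorable (k : nat) (G : sgraph) : Prop :=
  exists f : G -> 'I_k, forall x y : G, adj x y -> f x != f y.

(* The edges joining cyclically consecutive vertices of [s]. *)
Definition cycle_edges (G : sgraph) (s : seq G) : {set {set G}} :=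
  [set [set x; next s x] | x in s].

(* A cycle, as a subgraph, has no isolated vertex, so it is identified with its
   edge set; the choice of a starting vertex and of a direction is thereby
   forgotten, and the length of the cycle [C] is [#|C|]. The bound on [n] only
   serves to make the predicate boolean, see [is_cycleP]. *)
Definition is_cycle (G : sgraph) (C : {set {set G}}) : bool :=
  [exists n : 'I_#|G|.+1, exists t : n.-tuple G,
    [&& 2 < size t, cycle (@adj G) t, uniq t & C == cycle_edges t]].

Lemma is_cycleP (G : sgraph) (C : {set {set G}}) :
  reflect (exists s : seq G,
             [/\ 2 < size s, cycle (@adj G) s, uniq s & C = cycle_edges s])
          (is_cycle C).
Proof.
apply: (iffP existsP) => [[n /existsP[t /and4P[h1 h2 h3 /eqP h4]]]|].
  by exists t; split.
case=> s [h1 h2 h3 h4].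
have hs : size s < #|G|.+1 by rewrite ltnS -(card_uniqP h3) max_card.
exists (Ordinal hs); apply/existsP; exists (in_tuple s).
by rewrite h1 h2 h3 h4 eqxx.
Qed.

Lemma card_cycle_edges (G : sgraph) (s : seq G) :
  2 < size s -> uniq s -> #|cycle_edges s| = size s.
Proof.
move=> s3 us; rewrite card_in_imset ?(card_uniqP us) // => x y xs ys exy.
apply/eqP/negPn/negP => nxy.
have /set2P[/eqP|xny] : x \in [set y; next s y] by rewrite -exy set21.
  by rewrite (negPf nxy).
have /set2P[/eqP|ynx] : y \in [set x; next s x] by rewrite exy set21.
  by rewrite eq_sym (negPf nxy).
have [i s' es] := rot_to xs.
have us' : uniq (x :: s') by rewrite -es rot_uniq.
have ss' : size (x :: s') = size s by rewrite -es size_rot.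
move: xny ynx; rewrite -!(next_rot i us) es.
case: s' us' ss' {es} => [|z [|w s']] /= us' ss'; try by rewrite -ss' in s3.
rewrite eqxx => xny yz; move: xny us'; rewrite yz eqxx.
case: eqP => [->|_ ->]; first by rewrite !inE eqxx.
by rewrite !inE eqxx !orbT.
Qed.

Definition cycles_through (G : sgraph) (e : {set G}) (r : nat) :
    {set {set {set G}}} :=
  [set C | [&& is_cycle C, e \in C & #|C| == 1 %[mod r]]].

(* Main.v *)
Require Import Defs.
From mathcomp Require Import all_boot.

Set Implicit Arguments.
Unset Strict Implicit.
Unset Printing Implicit Defensive.

(** Let [e] join [x] and [y], and let [f] be a proper [k]-colouring of [G - e].
The ends of [e] have the same colour [f x], since otherwise [f] would colour [G].

Fix a cyclic order [c] on [r] distinct colours, starting at [f x]; there are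
[(k - 1) * ... * (k - r + 1)] of them. Orient an edge from [u] to [v] when the
colour of [v] is the successor in [c] of the colour of [u], and let [S] be the
set of vertices reachable from [x]. Replacing the colour of every vertex of [S]
by its successor creates no conflict on an edge inside [S], because taking
successors permutes the colours, nor on an edge leaving [S], because its outer
end would otherwise be reachable. If [y] were not in [S], then [e] itself would
be an edge leaving [S], and the new colouring would be proper on all of [G].
So there is a directed path from [x] to [y] ([step_path]).

Along this path the colours run round [c], and they start and end with [f x];
hence its length is a positive multiple of [r], and [e] closes it to a cycle of
length 1 modulo [r]. Moreover the first [r] vertices of the path spell out [c]
([step_path_colors]), and the path is determined by the edge set of the cycle
and the direction in which [e] is traversed ([cycle_edges_inj]), so that
distinct orders [c] give distinct cycles. *)

Section Next.
Variable T : eqType.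
Implicit Types (x v : T) (p s : seq T).

Lemma fpath_next x p : uniq (x :: p) -> fpath (next (x :: p)) x p.
Proof. by move/cycle_next => /=; rewrite rcons_path => /andP[]. Qed.

Lemma traject_next x p :
  uniq (x :: p) -> x :: p = traject (next (x :: p)) x (size p).+1.
Proof. by move=> us; rewrite trajectS -fpathE ?fpath_next. Qed.

Lemma next_last x p : uniq (x :: p) -> next (x :: p) (last x p) = x.
Proof.
move=> us; have /= := cycle_next us.
by rewrite rcons_path => /andP[_ /eqP].
Qed.

Lemma iter_next_mod x p i : uniq (x :: p) ->
  iter i (next (x :: p)) x = nth x (x :: p) (i %% (size p).+1).
Proof.
move=> us; set f := next _.
have per : iter (size p).+1 f x = x.
  by rewrite iterS -last_traject -fpathE ?fpath_next // /f next_last.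
rewrite (traject_next us) nth_traject ?ltn_mod // {1}(divn_eq i (size p).+1).
by rewrite addnC iterD iterM (iter_fix _ per).
Qed.

(** Otherwise two steps forward from [v] would lead back to [v], and the cycle
would have at most two vertices. *)
Lemma next_neq_prev s v :
  2 < size s -> uniq s -> v \in s -> next s v != prev s v.
Proof.
move=> s3 us vs; rewrite -(inj_eq (can_inj (prev_next us))) next_prev //.
have [i s' es] := rot_to vs.
have us' : uniq (v :: s') by rewrite -es rot_uniq.
have ss' : size (v :: s') = size s by rewrite -es size_rot.
rewrite -!(next_rot i us) es.
case: s' us' ss' {es} => [|a [|b s']] /= us' ss'; try by rewrite -ss' in s3.
move: us'; rewrite !inE !negb_or eqxx => /andP[/and3P[va vb _] _].
by rewrite [a == v]eq_sym (negPf va) eqxx eq_sym.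
Qed.

End Next.

(** A cycle has only two edges at [v], so once the cycles agree on the edge by
which they enter [v], they agree on the edge by which they leave it. *)
Lemma next_eq (G : sgraph) (s s' : seq G) v :
    2 < size s -> uniq s -> uniq s' -> cycle_edges s = cycle_edges s' ->
    v \in s -> prev s v = prev s' v ->
  next s v = next s' v.
Proof.
move=> s3 us us' ec vs epr.
(* The edge of [s] leaving [v] is also the edge of [s'] leaving some [w]; any
   case but [next s v = next s' v] makes [next s v] equal to [prev s v]. *)
have : [set v; next s v] \in cycle_edges s'.
  by rewrite -ec; apply/imsetP; exists v.
case/imsetP => w _ ew; have nv := next_neq_prev s3 us vs.
have /set2P[vw|vw] : v \in [set w; next s' w] by rewrite -ew set21.
  subst w; have /set2P[nE|//] : next s v \in [set v; next s' v].
    by rewrite -ew set22.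
  by case/eqP: nv; rewrite -{2}nE prev_next.
have /set2P[nE|nE] : next s v \in [set w; next s' w] by rewrite -ew set22.
  by case/eqP: nv; rewrite epr nE vw prev_next.
by case/eqP: nv; rewrite -{2}[v](_ : next s v = v) ?prev_next // nE.
Qed.

(** The edge set forgets the starting point and the direction of a cycle. Both
are restored by the first vertex and the vertex before it; from there the cycle
can be followed step by step. *)
Lemma cycle_edges_inj (G : sgraph) (x : G) (p p' : seq G) :
    1 < size p -> 1 < size p' -> uniq (x :: p) -> uniq (x :: p') ->
    last x p = last x p' -> cycle_edges (x :: p) = cycle_edges (x :: p') ->
  x :: p = x :: p'.
Proof.
set s := x :: p; set s' := x :: p' => p1 p1' us us' el ec.
have es : size s = size s'.
  by rewrite -card_cycle_edges // ec card_cycle_edges.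
have prev_x q : uniq (x :: q) -> prev (x :: q) x = last x q.
  by move=> uq; rewrite -{2}(next_last uq) prev_next.
have inv i : [/\ iter i (next s) x \in s, iter i (next s) x = iter i (next s') x
    & prev s (iter i (next s) x) = prev s' (iter i (next s) x)].
  elim: i => [|i [ins eit epr]].
    split; [exact: mem_head | by [] |].
    exact: etrans (prev_x p us) (etrans el (esym (prev_x p' us'))).
  have en := next_eq (p1 : 2 < size s) us us' ec ins epr.
  by rewrite !iterS -eit mem_next -en prev_next // en prev_next.
apply: (@eq_from_nth _ x) => // i lti.
rewrite [s](traject_next us) [s'](traject_next us') -/s -/s'.
by rewrite !nth_traject //; [case: (inv i) | rewrite -[(size p').+1]es].
Qed.

Lemma eq_color_ends (G : sgraph) (k : nat) (x y : G) (f : G -> 'I_k) :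
    (forall u v : G, adj u v -> [set u; v] != [set x; y] -> f u != f v) ->
    ~ colorable k G ->
  f x = f y.
Proof.
move=> fP ncol; apply/eqP/negPn/negP => nfxy; apply: ncol; exists f => u v uv.
have [euv|/fP] := eqVneq [set u; v] [set x; y]; last exact.
have /set2P[uE|uE] : u \in [set x; y] by rewrite -euv set21.
  subst u; have /set2P[yE|<- //] : y \in [set x; v] by rewrite euv set22.
  by rewrite yE eqxx in nfxy.
subst u; have /set2P[|<-] : x \in [set y; v] by rewrite euv set21.
  by move=> xE; rewrite xE eqxx in nfxy.
by rewrite eq_sym.
Qed.

(** The orientation of [G] by the cyclic order [c] on colours. As [next] fixes
what lies outside [c], no properly coloured edge starts at such a colour. *)
Definition step (G : sgraph) (C : eqType) (f : G -> C) (c : seq C) : rel G :=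
  fun u v => adj u v && (f v == next c (f u)).

(** If [y] were unreachable from [x], moving the colours of the reachable vertices
one place along [c] would turn [f] into a proper colouring of the whole graph. *)
Lemma step_path (G : sgraph) (k : nat) (x y : G) (f : G -> 'I_k) t :
    (forall u v : G, adj u v -> [set u; v] != [set x; y] -> f u != f v) ->
    ~ colorable k G -> uniq (f x :: t) ->
  exists p, [/\ path (step f (f x :: t)) x p, uniq (x :: p) & last x p = y].
Proof.
set c := f x :: t; set S := connect (step f c) x => fP ncol uc.
suff /connectP[p pP ->] : S y by case/shortenP: pP => p' ? ? _; exists p'.
apply/negPn/negP => nSy; case: ncol.
have nextI : injective (next c) := can_inj (prev_next uc).
pose g v := if S v then next c (f v) else f v.
(* No conflict on an edge leaving [S]: its outer end would be reachable. *)
have half u v : adj u v -> S u -> ~~ S v -> g u != g v.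
  move=> uv Su nSv; rewrite /g Su (negPf nSv); apply: contra nSv => /eqP fv.
  by apply: connect_trans Su (connect1 _); rewrite /step uv fv eqxx.
exists g => u v uv; case Su: (S u); case Sv: (S v); last 1 first.
- rewrite /g Su Sv; apply: fP => //; apply/eqP => euv.
  have : x \in [set u; v] by rewrite euv set21.
  by case/set2P => xE; move: Su Sv; rewrite -xE /S connect0.
- rewrite /g Su Sv (inj_eq nextI); apply: fP => //; apply/eqP => euv.
  have : y \in [set u; v] by rewrite euv set22.
  by case/set2P => yE; move: nSy; rewrite yE ?Su ?Sv.
- by apply: half; rewrite // Sv.
by rewrite eq_sym; apply: half; rewrite ?Su // adj_sym.
Qed.

(** The colours along the path are the iterates of [next], hence periodic of
period exactly the length of the cyclic order; so the path can only return to
its first colour after whole turns, and its first turn lists the order. *)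
Lemma step_path_colors (G : sgraph) (C : eqType) (f : G -> C) x p t :
    path (step f (f x :: t)) x p -> uniq (f x :: t) -> f (last x p) = f x ->
    0 < size p ->
  (size t).+1 %| size p /\ f x :: t = take (size t).+1 (map f (x :: p)).
Proof.
set c := f x :: t => pP uc lp p0.
have fp : fpath (next c) (f x) (map f p).
  by rewrite path_map; apply: sub_path pP => u v /andP[_]; rewrite eq_sym.
have trE : map f (x :: p) = traject (next c) (f x) (size p).+1.
  by rewrite trajectS /= -(size_map f) -fpathE.
have := iter_next_mod (size p) uc.
rewrite -last_traject -(size_map f p) -fpathE //.
rewrite last_map lp size_map => /esym/eqP.
(* The last colour is the entry of [c] of index [size p] modulo the period, the
   first one is the entry of index 0, and the entries of [c] are distinct. *)
rewrite -[X in _ == X]/(nth (f x) c 0) nth_uniq ?ltn_mod // => dvd.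
split=> //; rewrite trE take_traject; first exact: traject_next.
by rewrite ltnS ltnW // dvdn_leq.
Qed.

Theorem theorem1 (r k : nat) (G : sgraph) (e : {set G}) :
  2 <= r -> r <= k ->
  e \in edges G ->
  colorable k (del_edge e) ->
  ~ colorable k G ->
  \prod_(1 <= i < r) (k - i) <= #|cycles_through e r|.
Proof.
move=> r2 rk /imsetP[[x y]]; rewrite inE /= => xy ->{e} [f0 fP0] ncol.
have [f fP] : exists f : G -> 'I_k, forall u v : G,
    adj u v -> [set u; v] != [set x; y] -> f u != f v.
  by exists f0 => u v uv ne; apply: (fP0 u v); rewrite /= /del_adj uv.
have fxy := eq_color_ends fP ncol.
have nxy : x != y by apply: contraTneq xy => ->; rewrite adj_irr.
(* A cyclic order starting at [f x] is encoded by the [r.-1] colours after it. *)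
pose A := [set t : (r.-1).-tuple 'I_k | all (predC1 (f x)) t & uniq t].
have -> : \prod_(1 <= i < r) (k - i) = #|A|.
  rewrite card_uniq_tuples cardC1 card_ord ffact_prod.
  rewrite -(prednK (ltnW r2)) big_add1 /= big_mkord; apply: eq_bigr => i _.
  by rewrite -[k.-1]subn1 -subnDA.
have uA (t : (r.-1).-tuple 'I_k) : t \in A -> uniq (f x :: t).
  rewrite inE /= => /andP[/allP nt ->]; rewrite andbT.
  by apply/negP => /nt /=; rewrite eqxx.
have st (t : (r.-1).-tuple 'I_k) : (size t).+1 = r.
  by rewrite size_tuple prednK // ltnW.
pose P (t : (r.-1).-tuple 'I_k) p :=
  [/\ path (step f (f x :: t)) x p, uniq (x :: p) & last x p = y].
have p0 t p : P t p -> 0 < size p.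
  by case: p => // -[_ _ /= exy]; rewrite exy eqxx in nxy.
have PE t p : t \in A -> P t p ->
    [/\ 1 < size p, r %| size p & f x :: t = take r (map f (x :: p))].
  move=> tA Pp; have p_gt0 := p0 _ _ Pp; case: Pp => pP up lp.
  have [] := step_path_colors pP (uA _ tA) _ p_gt0; first by rewrite lp.
  by rewrite st => rp ?; split=> //; apply: leq_trans r2 (dvdn_leq _ rp).
(* Choose one path for each order; [F] maps the order to the closed-up cycle. *)
have [F FP FB] : exists2 F : (r.-1).-tuple 'I_k -> {set {set G}},
    forall t, t \in A -> exists2 p, P t p & F t = cycle_edges (x :: p)
    & forall t, t \in A -> F t \in cycles_through [set x; y] r.
  apply: (@fin_all_exists2 _ (fun=> {set {set G}})
    (fun t C => t \in A -> exists2 p, P t p & C = cycle_edges (x :: p))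
    (fun t C => t \in A -> C \in cycles_through [set x; y] r)) => t.
  have [tA|] := boolP (t \in A); last first.
    by exists set0.
  have [p Pp] := step_path fP ncol (uA _ tA).
  exists (cycle_edges (x :: p)) => _; first by exists p.
  have [p1 rp _] := PE _ _ tA Pp; case: Pp => pP up lp.
  rewrite inE card_cycle_edges //; apply/and3P; split.
  - apply/is_cycleP; exists (x :: p); split=> //=.
    rewrite rcons_path lp adj_sym xy andbT.
    by apply: sub_path pP => u v /andP[].
  - apply/imsetP; exists y; first by rewrite -lp mem_last.
    by rewrite -{3}lp next_last // setUC.
  by rewrite /= -addn1 -modnDml (eqP rp).
rewrite -(card_in_imset (f := F) (D := A)).
  by apply: subset_leq_card; apply/subsetP => _ /imsetP[t /FB ? ->].
move=> t t' tA t'A eF.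
have [p Pp Ft] := FP _ tA; have [p' Pp' Ft'] := FP _ t'A.
have [p1 _ tE] := PE _ _ tA Pp; have [p1' _ tE'] := PE _ _ t'A Pp'.
have [[_ up lp] [_ up' lp']] := (Pp, Pp').
have epp : x :: p = x :: p'.
  by apply: cycle_edges_inj => //; rewrite ?lp ?lp' // -Ft -Ft'.
apply: val_inj; have : f x :: t = f x :: t' by rewrite tE tE' epp.
by case.
Qed.
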